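(* Let $S$ be a finite set with $|S|\ge 2$, let $d\ge1$, and let $p\in(1,\infty]$. There exists no cost function $c:S^{\mathbb{Z}^d}\times S^{\mathbb{Z}^d}\to[0,\infty)$ for which $$\sup_{f\text{ local},\ \|\delta f\|_p\le1}\mathrm{Lip}_c(f)<\infty.$$
   Context: A function $f:S^{\mathbb{Z}^d}\to\mathbb{R}$ is local if it depends only on finitely many coordinates. The oscillation at site $i\in\mathbb{Z}^d$ is $\delta_i f=\sup\{f(\sigma)-f(\tilde\sigma):\sigma_j=\tilde\sigma_j\ \forall j\neq i\}$; $\|\delta f\|_p=(\sum_{i}(\delta_i f)^p)^{1/p}$ for $p<\infty$ and $\|\delta f\|_\infty=\sup_i\delta_i f$. A cost function is any nonnegative function $c:S^{\mathbb{Z}^d}\times S^{\mathbb{Z}^d}\to[0,\infty)$, and $$\mathrm{Lip}_c(f)=\inf\{L\ge0:\ |f(\sigma)-f(\sigma')|\le L\,c(\sigma,\sigma')\ \ \forall\sigma,\sigma'\in S^{\mathbb{Z}^d}\},$$ with the convention $\inf\emptyset=+\infty$. *)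

(* Defs.v *)
From HB Require Import structures.
From mathcomp Require Import all_boot all_order all_algebra.
From mathcomp Require Import all_classical all_reals all_analysis.

Set Implicit Arguments.
Unset Strict Implicit.
Unset Printing Implicit Defensive.

Import Order.TTheory GRing.Theory Num.Theory.

Local Open Scope classical_set_scope.
Local Open Scope ring_scope.

Definition site (d : nat) := 'rV[int]_d.
Definition config (S : finType) (d : nat) := site d -> S.

Section Oscillation.
Variables (R : realType) (S : finType) (d : nat).
Implicit Types (f : config S d -> R) (c : config S d -> config S d -> R).

Definition local_fun f :=
  exists2 A : set (site d), finite_set A &
    forall s t : config S d, (forall j, A j -> s j = t j) -> f s = f t.

(* The supremum is taken in the extended reals, so that it makes sense for an
   arbitrary, possibly unbounded, f. *)
Definition osc f (i : site d) : \bar R :=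
  ereal_sup [set x | exists s t : config S d,
    (forall j, j != i -> s j = t j) /\ x = (f s - f t)%:E].

(* Only 1 <= p <= +oo is meaningful; the value at p = -oo is a dummy. *)
Definition osc_norm (p : \bar R) f : \bar R :=
  match p with
  | r%:E => poweR (\esum_(i in [set: site d]) poweR (osc f i) r) r^-1
  | +oo%E => ereal_sup (range (osc f))
  | -oo%E => 0%E
  end.

(* [ereal_inf set0] is +oo. *)
Definition Lip c f : \bar R :=
  ereal_inf [set L%:E | L in [set L : R |
    0 <= L /\ forall s t : config S d, `|f s - f t| <= L * c s t]].

End Oscillation.

(* Main.v *)
Require Import Defs.
From mathcomp Require Import all_boot all_order all_algebra.
From mathcomp Require Import all_classical all_reals all_analysis.

Import Order.TTheory GRing.Theory Num.Theory.

Local Open Scope classical_set_scope.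
Local Open Scope ring_scope.

(** Let [a != b] in [S] and let [f] be [w] times the number of sites in a set of
    [n] sites at which the configuration equals [a]. Then [f] is local and its
    oscillation is at most [w] on the [n] sites and zero elsewhere, so that
    [w = n^(-1/p)] (or [w = 1] for [p = +oo]) gives [||delta f||_p <= 1]. Between
    the constant configurations [a] and [b], however, [f] varies by
    [n w = n^(1 - 1/p)], which is unbounded in [n], whereas the cost of this one
    pair is a fixed real number. *)

Section CountingFunction.
Context {R : realType} {S : finType} {d : nat}.
Implicit Types (f : config S d -> R) (e : nat -> site d) (a b : S) (w r : R).
Implicit Types (n k : nat).

Definition count_fun e a w n (s : config S d) : R :=
  w * \sum_(k < n) (s (e k) == a)%:R.

Lemma local_count_fun e a w n : local_fun (count_fun e a w n).
Proof.
exists (e @` `I_n); first exact/finite_image/finite_II.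
move=> s t st; congr (_ * _); apply: eq_bigr => k _.
by rewrite st//=; exists k.
Qed.

Lemma count_fun_cst_diff e a b w n : a != b ->
  count_fun e a w n (fun=> a) - count_fun e a w n (fun=> b) = w *+ n.
Proof.
rewrite eq_sym => /negbTE ab; rewrite /count_fun eqxx ab !sumr_const !card_ord.
by rewrite mul0rn mulr0 subr0 mulr_natr.
Qed.

(** Since [e] is injective, a change at the single site [i] affects at most one summand, and the two
    indicators in it differ by at most 1. *)
Lemma osc_count_fun e a w n (i : site d) : injective e -> 0 <= w ->
  (osc (count_fun e a w n) i <= (if i \in e @` `I_n then w else 0)%:E)%E.
Proof.
move=> e_inj w0; apply: ge_ereal_sup => _ [s [t [st ->]]]; rewrite lee_fin.
rewrite /count_fun -mulrBr -sumrB.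
case: ifPn => [/set_mem[k /= kn ki]|/negP iNe]; last first.
  rewrite big1 ?mulr0// => k _; rewrite st ?subrr//.
  by apply/eqP => ki; apply: iNe; apply/mem_set; exists k => //=.
rewrite (bigD1 (Ordinal kn))//= [X in _ + X]big1 ?addr0.
  by rewrite ler_piMr//; do 2!case: (_ == _); rewrite ?subrr ?subr0 ?sub0r ?lerN10.
move=> l lk; rewrite st ?subrr// -ki; apply: contraNneq lk => /e_inj lk.
by apply/eqP/val_inj.
Qed.

(** The configuration [s] keeps the supremum from ranging over the empty set, where it would be
    -oo. *)
Lemma osc_ge0 f i (s : config S d) : (0 <= osc f i)%E.
Proof. by apply: ereal_sup_ubound; exists s, s; rewrite subrr. Qed.

Lemma esum_cst_image_II e w n : injective e -> 0 <= w ->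
  \esum_(i in e @` `I_n) w%:E = (w *+ n)%:E.
Proof.
move=> e_inj w0; rewrite esum_image; last by move=> ? ? _ _; exact: e_inj.
rewrite esum_fset; [|exact: finite_II|by move=> *; rewrite lee_fin].
by rewrite -fsbig_ord sumEFin sumr_const card_ord.
Qed.

Lemma osc_norm_count_fun e a w r n : injective e -> 0 <= w -> 0 < r ->
  (osc_norm r%:E (count_fun e a w n) <= ((w `^ r *+ n) `^ r^-1)%:E)%E.
Proof.
move=> e_inj w0 r0; rewrite /= -poweR_EFin; apply: gt0_ler_poweR.
- by rewrite invr_ge0 ltW.
- by rewrite in_itv/= leey andbT esum_ge0// => *; exact: poweR_ge0.
- by rewrite in_itv/= leey andbT lee_fin mulrn_wge0// powR_ge0.
rewrite -(esum_cst_image_II e) ?powR_ge0// [leRHS]esum_mkcond.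
apply: le_esum => i _; apply: (@le_trans _ _
  (poweR (if i \in e @` `I_n then w else 0)%:E r)).
  apply: gt0_ler_poweR; first exact: ltW.
  - by rewrite in_itv/= leey andbT (osc_ge0 _ _ (fun=> a)).
  - by rewrite in_itv/= leey andbT lee_fin; case: ifP.
  exact: osc_count_fun.
by case: ifP => _; rewrite poweR_EFin// powR0// gt_eqF.
Qed.

Lemma osc_norm_y_count_fun e a w n : injective e -> 0 <= w ->
  (osc_norm +oo (count_fun e a w n) <= w%:E)%E.
Proof.
move=> e_inj w0; apply: ge_ereal_sup => _ [i _ <-].
apply: le_trans (osc_count_fun _ _ _ _ _ e_inj w0) _.
by rewrite lee_fin; case: ifP.
Qed.

End CountingFunction.

Lemma injective_const_site d : (0 < d)%N ->
  injective (fun k => const_mx k%:Z : site d).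
Proof.
by move=> d0 k l /rowP/(_ (Ordinal d0)); rewrite !mxE => -[].
Qed.

(** The strict inequality yields an admissible constant below [L], so attainment of the infimum is
    not at issue; as [c] is nonnegative, this constant may be enlarged to [L]. *)
Lemma Lip_lt_le {R : realType} {S : finType} {d : nat}
    (c : config S d -> config S d -> R) (f : config S d -> R) (L : R) :
  (forall s t, 0 <= c s t) -> (Lip c f < L%:E)%E ->
  forall s t, `|f s - f t| <= L * c s t.
Proof.
move=> c0 /ereal_inf_lt[_ [K [_ fK] <-]]; rewrite lte_fin => /ltW KL s t.
by apply: le_trans (fK s t) _; rewrite ler_wpM2r.
Qed.

Lemma osc_norm_unit_unbounded {R : realType} {S : finType} {d : nat}
    (e : nat -> site d) (a b : S) (p : \bar R) (K : R) :
  injective e -> a != b -> (1%:E < p)%E -> 0 <= K ->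
  exists f : config S d -> R, [/\ local_fun f, (osc_norm p f <= 1%:E)%E &
    K < f (fun=> a) - f (fun=> b)].
Proof.
move=> e_inj ab p1 K0; case: p p1 => [r||]//; last first.
  move=> _; exists (count_fun e a 1 (Num.bound K)); split.
  - exact: local_count_fun.
  - exact: osc_norm_y_count_fun.
  - by rewrite count_fun_cst_diff// archi_boundP.
rewrite lte_fin => r1; have r0 : 0 < r by exact: lt_trans r1.
have q0 : 0 < 1 - r^-1 by rewrite subr_gt0 invf_lt1.
(* This [n] solves [K < n ^ (1 - 1/r)]; the exponent is positive because [r > 1]. *)
pose n := Num.bound (K `^ (1 - r^-1)^-1).
have Kn : K `^ (1 - r^-1)^-1 < n%:R by rewrite archi_boundP// powR_ge0.
have n0 : 0 < n%:R :> R by apply: le_lt_trans Kn; exact: powR_ge0.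
exists (count_fun e a (n%:R `^ (- r^-1)) n); split.
- exact: local_count_fun.
- apply: le_trans (osc_norm_count_fun _ _ _ _ _ e_inj _ r0) _.
    exact: powR_ge0.
  rewrite -powRrM mulNr mulVf ?gt_eqF// powR_inv1 ?(ltW n0)//.
  by rewrite -[_ *+ n]mulr_natr mulVf ?gt_eqF// powR1.
- rewrite count_fun_cst_diff// -[ltRHS]mulr_natl.
  have -> : n%:R * n%:R `^ (- r^-1) = n%:R `^ (1 - r^-1).
    by rewrite powRD ?(gt_eqF n0) ?implybT// powRr1// ltW.
  have -> : K = (K `^ (1 - r^-1)^-1) `^ (1 - r^-1).
    by rewrite -powRrM mulVf ?powRr1// gt_eqF.
  by rewrite gt0_ltr_powR// nnegrE ?powR_ge0// ltW.
Qed.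

Theorem propositionA1 (R : realType) (S : finType) (d : nat) (p : \bar R)
    (hS : (2 <= #|S|)%N) (hd : (1 <= d)%N) (hp : (1%:E < p)%E) :
  ~ exists c : config S d -> config S d -> R,
      (forall s t : config S d, 0 <= c s t) /\
      (ereal_sup [set Lip c f | f in
         [set f : config S d -> R | local_fun f /\ (osc_norm p f <= 1%:E)%E]]
       < +oo)%E.
Proof.
move=> [c [c0]]; set M := ereal_sup _ => My.
have [a [b [_ _ ab]]] := card_gt1P hS.
(* [L] lies strictly above [M], as [Lip_lt_le] requires; the case [M = -oo] is covered by
   [L = 0]. *)
have [L L0 ML] : exists2 L : R, 0 <= L & (M < L%:E)%E.
  move: My; case: M => [m _| |_]; [|by rewrite ltxx|by exists 0; rewrite ?ltNyr].
  by exists (`|m| + 1); rewrite ?addr_ge0// lte_fin ltr_pwDr// ler_norm.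
(* The bound to be exceeded is the largest variation that [L] allows between the two constant
   configurations. *)
have [||f [flocal f1]] := osc_norm_unit_unbounded _ _ _ p
  (L * c (fun=> a) (fun=> b)) (injective_const_site d hd) ab.
- by [].
- exact: mulr_ge0.
apply/negP; rewrite -leNgt; apply: le_trans (ler_norm _) _.
apply: (Lip_lt_le c f L c0); apply: le_lt_trans ML.
by apply: ereal_sup_ubound; exists f.
Qed.
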